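(* Let $A$ be a finite set with $|A|\ge 2$, let $n\ge 2$, and let $f$ be a permutation of $A^n$. If $n=2m$ is even, then $f$ can be computed in at most $3m$ instructions with $m$ memory cells. If $n=2m+1$ is odd, then $f$ can be computed in at most $3m+3$ instructions with $m+2$ memory cells.
   Context: For $N\ge1$, a transformation of $A^N$ is a map $h=(h_1,\dots,h_N):A^N\to A^N$; its coordinate function $h_i:A^N\to A$ is trivial if $h_i(x)=x_i$ for all $x$. An instruction of $A^N$ is a transformation of $A^N$ with at most one nontrivial coordinate function. A program of length $L$ computing $h$ is a sequence of instructions $g^1,\dots,g^L$ of $A^N$ with $h=g^L\circ\cdots\circ g^1$. A transformation $f$ of $A^n$ is said to be computed in $L$ instructions with $k$ memory cells if there is a program of length $L$ (with instructions of $A^{n+k}$) computing some transformation $h$ of $A^{n+k}$ with $h_i(x_1,\dots,x_{n+k})=f_i(x_1,\dots,x_n)$ for all $1\le i\le n$ and all $(x_1,\dots,x_{n+k})\in A^{n+k}$. *)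

(* Defs.v *)
From mathcomp Require Import all_boot.

Set Implicit Arguments.
Unset Strict Implicit.
Unset Printing Implicit Defensive.

Definition transformation (A : finType) (N : nat) : Type :=
  {ffun 'I_N -> A} -> {ffun 'I_N -> A}.

Definition trivial_coordinate (A : finType) N (h : transformation A N) (i : 'I_N) : bool :=
  [forall x : {ffun 'I_N -> A}, h x i == x i].

Definition instruction (A : finType) N (h : transformation A N) : bool :=
  #|[set i : 'I_N | ~~ trivial_coordinate h i]| <= 1.

(* The head of the list is executed first:
   run [:: g1; ...; gL] = gL \o ... \o g1. *)
Definition run (A : finType) N (p : seq (transformation A N)) : transformation A N :=
  foldl (fun acc g => g \o acc) id p.

Definition program_computing (A : finType) N (p : seq (transformation A N))
    (h : transformation A N) : Prop :=
  all (@instruction A N) p /\ run p =1 h.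

(* The n inputs are the first n registers of A^(n + k), embedded by lshift;
   the memory cells are the last k, with arbitrary initial contents. *)
Definition inputs (A : finType) n k (x : {ffun 'I_(n + k) -> A}) : {ffun 'I_n -> A} :=
  [ffun i => x (lshift k i)].

Definition computed_in (A : finType) n (f : transformation A n) (L k : nat) : Prop :=
  exists (p : seq (transformation A (n + k))) (h : transformation A (n + k)),
    [/\ size p = L,
        program_computing p h
      & forall (i : 'I_n) (x : {ffun 'I_(n + k) -> A}),
          h x (lshift k i) = f (inputs x) i].

Definition computed_in_at_most (A : finType) n (f : transformation A n) (L k : nat) : Prop :=
  exists2 l, l <= L & computed_in f l k.

(* Main.v *)
(** Split the registers into three blocks [X], [Y], [Z] of [k] registers, the
    inputs lying in [X] and [Y]; if [n] is odd, one memory cell is treated as an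
    additional input that has to be preserved.  With [V = A^k] the task is to
    apply a permutation [F] of [V * V] to [(X, Y)].  Write [Z := g (X, Y)], then
    [X := (F (X, Y)).1], then [Y := (F (X, Y)).2]: the original contents can be
    recovered from [(Y, Z)] in the second step and from the new [X] and [Z] in
    the third one as soon as [e |-> (e.2, g e)] and [e |-> ((F e).1, g e)] are
    injective.  Such a [g] is a proper edge colouring, with [#|V|] colours, of
    the [#|V|]-regular bipartite multigraph in which [e : V * V] joins [e.2] to
    [(F e).1]; it exists by König's theorem. *)
Require Import Defs.
From mathcomp Require Import all_boot.

Set Implicit Arguments.
Unset Strict Implicit.
Unset Printing Implicit Defensive.

(** * Hall's marriage theorem *)

Section Hall.
Variables S T : finType.

Definition neighbours (r : S -> {set T}) (X : {set S}) := \bigcup_(x in X) r x.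

Lemma neighboursD (r : S -> {set T}) (B : {set T}) (X : {set S}) :
  neighbours (fun x => r x :\: B) X = neighbours r X :\: B.
Proof.
apply/setP=> t; rewrite inE; apply/bigcupP/andP.
  by case=> x xX; rewrite inE => /andP[tB tx]; split=> //; apply/bigcupP; exists x.
by case=> tB /bigcupP[x xX tx]; exists x; rewrite // inE tB.
Qed.

Theorem hall (t0 : T) (r : S -> {set T}) (D : {set S}) :
  (forall X : {set S}, X \subset D -> #|X| <= #|neighbours r X|) ->
  exists2 m : S -> T, {in D &, injective m} & forall x, x \in D -> m x \in r x.
Proof.
(* The induction is on [#|D|] with [r] general, because the rest of [D] is matched using fewer
   targets. *)
elim: {D}_.+1 {-2}D r (ltnSn #|D|) => // c IH D r; rewrite ltnS => leDc hallD.
(* Halmos and Vaughan: match first a tight proper subset [X] of [D] if there is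
   one, otherwise an arbitrary single element. *)
have combine (X : {set S}) (B : {set T}) (m1 : S -> T) :
    X \subset D -> X != set0 -> {in X &, injective m1} ->
    (forall x, x \in X -> (m1 x \in r x) && (m1 x \in B)) ->
    (forall Y : {set S}, Y \subset D :\: X -> #|Y| <= #|neighbours r Y :\: B|) ->
    exists2 m : S -> T, {in D &, injective m} & forall x, x \in D -> m x \in r x.
  move=> sXD X0 inj1 m1P hallY.
  have ltDX : #|D :\: X| < c.
    apply: leq_trans leDc; apply/proper_card/properP; split; first exact: subsetDl.
    by case/set0Pn: X0 => x xX; exists x; [exact: (subsetP sXD) | rewrite inE xX].
  (* The rest is matched outside [B], so its values cannot collide with those of [m1]. *)
  have [Y sY|m2 inj2 m2P] := IH (D :\: X) (fun x => r x :\: B) ltDX.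
    by rewrite neighboursD hallY.
  have m2B x : x \in D -> x \notin X -> (m2 x \in r x) && (m2 x \notin B).
    by move=> xD xX; move: (m2P x); rewrite !inE xX xD andbC => ->.
  exists (fun x => if x \in X then m1 x else m2 x) => [x y xD yD|x xD].
    case: ifP => xX; case: ifP => yX.
    - exact: inj1.
    - case/andP: (m1P x xX) => _ + e; rewrite e.
      by case/andP: (m2B y yD (negbT yX)) => _ /negbTE ->.
    - case/andP: (m1P y yX) => _ + e; rewrite -e.
      by case/andP: (m2B x xD (negbT xX)) => _ /negbTE ->.
    - by apply: inj2; rewrite inE ?xX ?yX.
  by case: ifP => xX; [case/andP: (m1P x xX) | case/andP: (m2B x xD (negbT xX))].
have [/existsP[X /and3P[pXD X0 tightX]]|noTight] :=
  boolP [exists X : {set S}, [&& X \proper D, X != set0 & #|neighbours r X| <= #|X|]].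
  have sXD := proper_sub pXD.
  have [Y sYX|m1 inj1 m1P] := IH X r (leq_trans (proper_card pXD) leDc).
    by apply: hallD; apply: subset_trans sXD.
  apply: (combine X (neighbours r X) m1) => // [x xX|Y sY].
    by rewrite m1P //; apply/bigcupP; exists x; rewrite ?m1P.
  have [sYD dYX] : Y \subset D /\ [disjoint Y & X].
    by apply/andP; rewrite -subsetD.
  (* Hall's condition for [X :|: Y], less the tightness of [X], leaves enough neighbours of [Y]
     outside those of [X]. *)
  have := hallD (X :|: Y); rewrite subUset sXD sYD => /(_ isT).
  rewrite cardsU [X :&: Y]setIC (disjoint_setI0 dYX) cards0 subn0.
  have -> : neighbours r (X :|: Y) = neighbours r X :|: (neighbours r Y :\: neighbours r X).
    by rewrite /neighbours bigcup_setU setDE setUIr setUCr setIT.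
  rewrite cardsU setIDA [_ :&: neighbours r Y]setIC -setIDA setDv setI0 cards0 subn0.
  move=> le; rewrite -(leq_add2l #|X|); apply: leq_trans le _.
  by rewrite leq_add2r.
have [->|/set0Pn[x xD]] := eqVneq D set0.
  by exists (fun=> t0) => x; rewrite inE.
have : 0 < #|r x|.
  have := hallD [set x]; rewrite sub1set xD /neighbours big_set1 cards1.
  exact.
case/card_gt0P=> t tx.
apply: (combine [set x] [set t] (fun=> t)); rewrite ?sub1set //.
- by apply/set0Pn; exists x; rewrite inE.
- by move=> y z; rewrite !inE => /eqP-> /eqP->.
- by move=> y; rewrite !inE => /eqP->; rewrite tx eqxx.
(* No tight set exists, so a nonempty [Y] has a spare neighbour and can lose [t]. *)
move=> Y sY; have [->|Y0] := eqVneq Y set0; first by rewrite cards0.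
move: noTight; rewrite negb_exists => /forallP/(_ Y).
rewrite Y0 (sub_proper_trans sY) ?properD1 //= -ltnNge => lt.
by rewrite -ltnS (leq_trans lt) // (cardsD1 t (neighbours r Y)) addnC -addn1 leq_add2l leq_b1.
Qed.
End Hall.

(** * Edge colourings of regular bipartite multigraphs *)

Section Koenig.
Variables E V : finType.

(** A bipartite multigraph is given by its edge set [D] and two endpoint maps into [V], one per
    side, so parallel edges are allowed; regularity is stated for one side at a time. *)
Definition regular (a : E -> V) (D : {set E}) (d : nat) :=
  forall v, #|[set e in D | a e == v]| = d.

Lemma card_regular (a : E -> V) (D : {set E}) (d : nat) (X : {set V}) :
  regular a D d -> #|[set e in D | a e \in X]| = #|X| * d.
Proof.
move=> reg; rewrite -sum1_card.
rewrite (partition_big a (mem X)) /=; last by move=> e; rewrite inE => /andP[].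
rewrite -sum_nat_const; apply: eq_bigr => v vX.
rewrite -(reg v) -sum1_card; apply: eq_bigl => e; rewrite !inE.
by case: eqP => [->|]; rewrite ?vX ?andbF ?andbT.
Qed.

(** Hall's condition follows by counting: the [#|X| * d.+1] edges leaving [X] all end in its
    neighbours, and only [d.+1] edges end at each vertex. The set [M] is a perfect matching. *)
Lemma regular_matching (v0 : V) (a b : E -> V) (D : {set E}) (d : nat) :
  regular a D d.+1 -> regular b D d.+1 ->
  exists2 M : {set E}, M \subset D & regular a M 1 /\ regular b M 1.
Proof.
move=> rega regb.
pose r v := [set b e | e in [set e in D | a e == v]].
have [X _|m injm mP] := @hall V V v0 r setT.
  rewrite -(leq_pmul2r (ltn0Sn d)) -(card_regular X rega).
  rewrite -(card_regular (neighbours r X) regb); apply/subset_leq_card/subsetP=> e.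
  rewrite !inE => /andP[eD aeX]; rewrite eD; apply/bigcupP; exists (a e) => //.
  by apply: imset_f; rewrite inE eD eqxx.
have exE v : exists e, [&& e \in D, a e == v & b e == m v].
  have /imsetP[e] := mP v (in_setT v).
  by rewrite inE => /andP[eD ae ->]; exists e; rewrite eD ae eqxx.
pose h v := xchoose (exE v).
have hP v : [/\ h v \in D, a (h v) = v & b (h v) = m v].
  by case/and3P: (xchooseP (exE v)) => -> /eqP-> /eqP->.
have minj : injective m by move=> x y; apply: injm.
exists [set h v | v : V].
  by apply/subsetP=> _ /imsetP[v _ ->]; case: (hP v).
split=> v; apply/eqP/cards1P.
  exists (h v); apply/setP=> e; rewrite !inE; apply/andP/eqP => [[]|->].
    by case/imsetP=> w _ -> /eqP <-; case: (hP w) => _ ->.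
  by rewrite imset_f //; case: (hP v) => _ ->.
(* An injective self-map of a finite type is bijective, so [M] also covers each vertex on the [b]
   side. *)
have [m' mK Km] := injF_bij minj.
exists (h (m' v)); apply/setP=> e; rewrite !inE; apply/andP/eqP => [[]|->].
  by case/imsetP=> w _ -> /eqP <-; case: (hP w) => _ _ ->; rewrite mK.
by rewrite imset_f //; case: (hP (m' v)) => _ _ ->; rewrite Km.
Qed.

Lemma regularD (a : E -> V) (D M : {set E}) (d : nat) :
  M \subset D -> regular a D d.+1 -> regular a M 1 -> regular a (D :\: M) d.
Proof.
move=> sMD regD regM v.
have -> : [set e in D :\: M | a e == v] =
          [set e in D | a e == v] :\: [set e in M | a e == v].
  by apply/setP=> e; rewrite !inE; case: (e \in M); case: (a e == v); rewrite ?andbF.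
rewrite cardsD (setIidPr _) ?regD ?regM ?subn1 //.
by apply/subsetP=> e; rewrite !inE => /andP[/(subsetP sMD)-> ->].
Qed.

Lemma regular1_inj (a : E -> V) (M : {set E}) :
  regular a M 1 -> {in M &, injective a}.
Proof.
move=> reg x y xM yM eqa; have /eqP/cards1P[z zP] := reg (a x).
have : x \in [set z] by rewrite -zP inE xM eqxx.
have : y \in [set z] by rewrite -zP inE yM eqa eqxx.
by rewrite !inE => /eqP-> /eqP->.
Qed.

(** Induction on the degree: a perfect matching receives a new colour, and removing it lowers the
    degree by one on both sides. *)
Theorem koenig_edge_colouring (v0 : V) (a b : E -> V) (D : {set E}) (d : nat) :
  regular a D d -> regular b D d ->
  exists2 g : E -> nat, forall e, e \in D -> g e < d &
    {in D &, injective (fun e => (a e, g e))} /\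
    {in D &, injective (fun e => (b e, g e))}.
Proof.
elim: d D => [|d IH] D rega regb.
  have D0 e : e \in D = false.
    by have /eqP := rega (a e); rewrite cards_eq0 => /eqP/setP/(_ e); rewrite !inE eqxx andbT.
  by exists (fun=> 0) => [e|]; [|split=> e]; rewrite D0.
have [M sMD [Ma Mb]] := regular_matching v0 rega regb.
have [g gd [ga gb]] := IH _ (regularD sMD rega Ma) (regularD sMD regb Mb).
pose g' e := if e \in M then d else g e.
have gd' e : e \in D -> e \notin M -> g e < d by move=> eD eM; rewrite gd ?inE ?eM.
have extend (c : E -> V) : regular c M 1 ->
    {in D :\: M &, injective (fun e => (c e, g e))} ->
    {in D &, injective (fun e => (c e, g' e))}.
  move=> Mc gc x y xD yD [eqc]; rewrite /g'.
  case: ifP => xM; case: ifP => yM eqg.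
  - exact: (regular1_inj Mc).
  - by have := gd' y yD (negbT yM); rewrite -eqg ltnn.
  - by have := gd' x xD (negbT xM); rewrite eqg ltnn.
  - by apply: gc; rewrite ?inE ?xM ?yM // eqc eqg.
exists g' => [e eD|]; last by split; apply: extend.
by rewrite /g'; case: ifP => // eM; rewrite ltnS ltnW ?gd' ?eM.
Qed.
End Koenig.

(** All pairs serve as edges from [e.2] to [(F e).1]; both sides have degree [#|V|], the second
    because [F] is bijective. The two injectivity claims say that distinct edges of equal colour
    share no endpoint. *)
Lemma common_complement (V : finType) (F : V * V -> V * V) : injective F ->
  exists g : V * V -> V,
    injective (fun e => (e.2, g e)) /\ injective (fun e => ((F e).1, g e)).
Proof.
move=> injF; have [/card0_eq V0|/card_gt0P[v0 _]] := posnP #|V|.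
  by exists snd; split=> -[x y]; have := V0 x; rewrite inE.
have reg2 : regular (fun e : V * V => e.2) setT #|V|.
  move=> v; rewrite -[RHS]muln1 -(cards1 v) -cardsT -cardsX; apply: eq_card => -[x y].
  by rewrite !inE.
have reg1 : regular (fun e : V * V => e.1) setT #|V|.
  move=> v; rewrite -[RHS]mul1n -(cards1 v) -cardsT -cardsX; apply: eq_card => -[x y].
  by rewrite !inE andbT.
have regF : regular (fun e => (F e).1) setT #|V|.
  move=> v; rewrite -(reg1 v) -(card_imset _ injF); apply: eq_card => e.
  have [F' FK KF] := injF_bij injF.
  by rewrite -{1}(KF e) (mem_imset _ _ injF) !inE KF.
have [g gV [g2 gF]] := koenig_edge_colouring v0 reg2 regF.
have gV' e : g e < #|V| by rewrite gV.
(* Colours below [#|V|] become elements of [V] through its enumeration. *)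
exists (fun e => enum_val (Ordinal (gV' e))).
by split=> x y [eq1 /enum_val_inj[eqg]]; [apply: g2 | apply: gF]; rewrite ?inE ?eq1 ?eqg.
Qed.

(** * Programs acting on blocks of registers *)

Section Registers.
Variables (A : finType) (N k : nat).
Implicit Types (r : 'I_k -> 'I_N) (x : {ffun 'I_N -> A}) (v : {ffun 'I_k -> A}).

Definition read r x : {ffun 'I_k -> A} := [ffun i => x (r i)].

Definition write r v x : {ffun 'I_N -> A} :=
  [ffun j => if [pick i | r i == j] is Some i then v i else x j].

Lemma write_in r v x i : injective r -> write r v x (r i) = v i.
Proof.
by move=> injr; rewrite ffunE; case: pickP => [j /eqP/injr->|/(_ i)] //; rewrite eqxx.
Qed.

Lemma write_out r v x j : (forall i, r i != j) -> write r v x j = x j.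
Proof.
by move=> nj; rewrite ffunE; case: pickP => // i; rewrite (negbTE (nj i)).
Qed.

Lemma read_write r v x : injective r -> read r (write r v x) = v.
Proof. by move=> injr; apply/ffunP=> i; rewrite ffunE write_in. Qed.

Lemma read_write_disjoint r r' v x :
  (forall i j, r i != r' j) -> read r' (write r v x) = read r' x.
Proof. by move=> dis; apply/ffunP=> i; rewrite ffunE write_out ?ffunE. Qed.

Definition update (j : 'I_N) (c : {ffun 'I_N -> A} -> A) : transformation A N :=
  fun x => [ffun i => if i == j then c x else x i].

Lemma instruction_update j c : instruction (update j c).
Proof.
rewrite /instruction -(cards1 j); apply/subset_leq_card/subsetP=> i; rewrite !inE.
by apply: contraR => ij; apply/forallP=> x; rewrite ffunE (negbTE ij).
Qed.

Lemma run_cat (p q : seq (transformation A N)) x : run (p ++ q) x = run q (run p x).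
Proof.
elim/last_ind: q => [|q g IH]; first by rewrite cats0.
by move: IH; rewrite -rcons_cat /run !foldl_rcons /= => ->.
Qed.

(** Since [phi] ignores the block being written, its value survives each single update, and [k]
    successive instructions act as one simultaneous assignment. *)
Lemma block_update r (phi : {ffun 'I_N -> A} -> {ffun 'I_k -> A}) :
  injective r -> (forall v x, phi (write r v x) = phi x) ->
  exists p : seq (transformation A N), [/\ size p = k, all (@instruction A N) p &
    forall x, run p x = write r (phi x) x].
Proof.
move=> injr phi_stable.
pose p s := [seq update (r i) (fun x => phi x i) | i <- s].
(* Invariant: the registers listed in [s] hold their new values, all others their old ones. *)
have runP s x : run (p s) x = write r [ffun i => if i \in s then phi x i else x (r i)] x.
  elim/last_ind: s => [|s i IH].
    by apply/ffunP=> j; rewrite ffunE; case: pickP => // i /eqP <-; rewrite ffunE.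
  rewrite /p -cats1 map_cat run_cat -/(p s) IH.
  apply/ffunP=> j; rewrite ffunE phi_stable.
  have [->|nij] := eqVneq j (r i).
    by rewrite write_in // ffunE mem_cat inE eqxx orbT.
  rewrite !ffunE; case: pickP => // i' /eqP rj; rewrite !ffunE mem_cat inE.
  suff /negbTE-> : i' != i by rewrite orbF.
  by apply: contraNneq nij => <-; rewrite rj.
exists (p (enum 'I_k)); split=> [||x].
- by rewrite size_map size_enum_ord.
- by rewrite all_map; apply/allP=> i _ /=; apply: instruction_update.
- by rewrite runP; congr write; apply/ffunP=> i; rewrite ffunE mem_enum.
Qed.

(** Each of the three phases reads only the two blocks that it does not write, as [block_update]
    demands. *)
Lemma three_blocks (r0 r1 r2 : 'I_k -> 'I_N)
    (F : {ffun 'I_k -> A} * {ffun 'I_k -> A} -> {ffun 'I_k -> A} * {ffun 'I_k -> A}) :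
  injective r0 -> injective r1 -> injective r2 ->
  (forall i j, r0 i != r1 j) -> (forall i j, r0 i != r2 j) ->
  (forall i j, r1 i != r2 j) -> injective F ->
  exists p : seq (transformation A N), [/\ size p = 3 * k, all (@instruction A N) p &
    forall x, (read r0 (run p x), read r1 (run p x)) = F (read r0 x, read r1 x)].
Proof.
move=> inj0 inj1 inj2 d01 d02 d12 injF.
have d10 i j : r1 i != r0 j by rewrite eq_sym.
have d20 i j : r2 i != r0 j by rewrite eq_sym.
have d21 i j : r2 i != r1 j by rewrite eq_sym.
(* [D1] recovers the old pair from [Y] and [Z], and [D2] from the new [X] and [Z]. *)
have [g [/injF_bij[D1 D1K _] /injF_bij[D2 D2K _]]] := common_complement injF.
have [|p1 [s1 i1 run1]] := @block_update r2 (fun x => g (read r0 x, read r1 x)) inj2.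
  by move=> v x; rewrite !read_write_disjoint.
have [|p2 [s2 i2 run2]] := @block_update r0 (fun x => (F (D1 (read r1 x, read r2 x))).1) inj0.
  by move=> v x; rewrite !read_write_disjoint.
have [|p3 [s3 i3 run3]] := @block_update r1 (fun x => (F (D2 (read r0 x, read r2 x))).2) inj1.
  by move=> v x; rewrite !read_write_disjoint.
exists (p1 ++ p2 ++ p3); split=> [||x].
- by rewrite !size_cat s1 s2 s3 !mulSn addn0.
- by rewrite !all_cat i1 i2 i3.
rewrite !run_cat run1 run2 run3.
do ![rewrite read_write // | rewrite read_write_disjoint //].
set e := (read r0 x, read r1 x).
rewrite (D1K e) (D2K e).
by case: (F e).
Qed.

Lemma block_subproof c (le_cN : c.+1 * k <= N) (i : 'I_k) : c * k + i < N.
Proof. by apply: leq_trans le_cN; rewrite mulSnr ltn_add2l. Qed.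

Definition block c (le_cN : c.+1 * k <= N) (i : 'I_k) : 'I_N :=
  Ordinal (block_subproof le_cN i).

Lemma block_inj c (le_cN : c.+1 * k <= N) : injective (block le_cN).
Proof. by move=> i j [/addnI/val_inj]. Qed.

Lemma block_neq c d (le_cN : c.+1 * k <= N) (le_dN : d.+1 * k <= N) i j :
  c < d -> block le_cN i != block le_dN j.
Proof.
move=> lt_cd; rewrite -val_eqE /= neq_ltn; apply/orP; left.
apply: (@leq_trans (c.+1 * k)); first by rewrite mulSnr ltn_add2l.
by apply: (leq_trans _ (leq_addr _ _)); rewrite leq_mul2r lt_cd orbT.
Qed.

Lemma block_surj c (le_cN : c.+1 * k <= N) (j : 'I_N) :
  c * k <= j < c.+1 * k -> exists i, j = block le_cN i.
Proof.
case/andP=> le_cj lt_jc; have ltk : j - c * k < k by rewrite ltn_subLR // -mulSnr.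
by exists (Ordinal ltk); apply: val_inj; rewrite /= subnKC.
Qed.

End Registers.

(** * Fitting the inputs into three blocks *)

(** The bound [n <= 2 * k] places all inputs in the first two blocks; memory cells sharing these
    blocks are treated as inputs that [ext] preserves. This covers both parities at once. *)
Lemma computed_in_blocks (A : finType) (n k k' : nat) (f : transformation A n) :
  0 < #|A| -> n <= 2 * k -> n + k' = 3 * k -> injective f ->
  computed_in f (3 * k) k'.
Proof.
case/card_gt0P=> a _ le_n_2k eN injf.
have le0 : 1 * k <= n + k' by rewrite eN leq_mul2r orbT.
have le1 : 2 * k <= n + k' by rewrite eN leq_mul2r orbT.
have le2 : 3 * k <= n + k' by rewrite eN.
pose r0 := @block _ k 0 le0; pose r1 := block le1; pose r2 := block le2.
have inj0 : injective r0 by apply: block_inj.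
have inj1 : injective r1 by apply: block_inj.
have d01 i j : r0 i != r1 j by apply: block_neq.
have d10 i j : r1 i != r0 j by rewrite eq_sym.
pose ext (x : {ffun 'I_(n + k') -> A}) : {ffun 'I_(n + k') -> A} :=
  [ffun j => if split j is inl i then f (inputs x) i else x j].
have ext_in x i : ext x (lshift k' i) = f (inputs x) i.
  by rewrite ffunE (unsplitK (inl i)).
have ext_out x (j : 'I_(n + k')) : n <= j -> ext x j = x j.
  by rewrite ffunE; case: splitP => // i -> /(leq_trans (ltn_ord i)); rewrite ltnn.
have inj_ext : injective ext.
  move=> x y eqxy; have /injf/ffunP eqi : f (inputs x) = f (inputs y).
    by apply/ffunP=> i; rewrite -!ext_in eqxy.
  apply/ffunP=> j; have [lt_jn|le_nj] := ltnP j n.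
    have -> : j = lshift k' (Ordinal lt_jn) by apply: val_inj.
    by have := eqi (Ordinal lt_jn); rewrite !ffunE.
  by rewrite -(ext_out x) // -(ext_out y) // eqxy.
have low_block (j : 'I_(n + k')) : j < 2 * k ->
    (exists i, j = r0 i) \/ (exists i, j = r1 i).
  move=> lt_j; have [lt_jk|le_kj] := ltnP j (1 * k).
    by left; apply: block_surj; rewrite mul0n.
  by right; apply: block_surj; rewrite le_kj.
(* Filling the third block with a fixed letter [a] turns [ext] into a map [F] on the contents of the
   first two blocks. *)
pose st (e : {ffun 'I_k -> A} * {ffun 'I_k -> A}) : {ffun 'I_(n + k') -> A} :=
  write r1 e.2 (write r0 e.1 [ffun=> a]).
have st0 e : read r0 (st e) = e.1 by rewrite read_write_disjoint // read_write.
have st1 e : read r1 (st e) = e.2 by rewrite read_write.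
have st_high e (j : 'I_(n + k')) : 2 * k <= j -> st e j = a.
  move=> le_j; have ne (r : 'I_k -> 'I_(n + k')) i : r i < 2 * k -> r i != j.
    by move=> lt; rewrite -val_eqE neq_ltn (leq_trans lt le_j).
  rewrite /st !write_out ?ffunE // => i; apply: ne => /=.
    by rewrite (leq_trans (ltn_ord i)) // leq_pmull.
  by rewrite (mulSnr 1 k) ltn_add2l.
pose F e := (read r0 (ext (st e)), read r1 (ext (st e))).
have injF : injective F.
  move=> d e [/ffunP eq0 /ffunP eq1].
  suff /inj_ext eqst : ext (st d) = ext (st e).
    by rewrite [d]surjective_pairing [e]surjective_pairing -!st0 -!st1 eqst.
  (* The images agree on the first two blocks by equality under [F]; beyond them lie no inputs, so
     both still hold [a]. *)
  apply/ffunP=> j; have [/low_block|le_j] := ltnP j (2 * k).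
    by case=> -[i ->]; [have := eq0 i | have := eq1 i]; rewrite !ffunE.
  by rewrite !ext_out ?st_high // (leq_trans le_n_2k le_j).
have inj2 : injective r2 by apply: block_inj.
have d02 i j : r0 i != r2 j by apply: block_neq.
have d12 i j : r1 i != r2 j by apply: block_neq.
have [p [sp ip runp]] := three_blocks inj0 inj1 inj2 d01 d02 d12 injF.
exists p, (run p); split=> // i x.
set e := (read r0 x, read r1 x) in runp *.
have inputs_st : inputs (st e) = inputs x.
  apply/ffunP=> i'; rewrite !ffunE.
  have /low_block[] : lshift k' i' < 2 * k by rewrite (leq_trans (ltn_ord i')).
    by case=> j ->; have /ffunP/(_ j) := st0 e; rewrite !ffunE.
  by case=> j ->; have /ffunP/(_ j) := st1 e; rewrite !ffunE.
rewrite -inputs_st -ext_in.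
have [/ffunP eq0 /ffunP eq1] := runp x.
have /low_block[] : lshift k' i < 2 * k by rewrite (leq_trans (ltn_ord i)).
  by case=> j ->; have := eq0 j; rewrite !ffunE.
by case=> j ->; have := eq1 j; rewrite !ffunE.
Qed.

Theorem theorem5 (A : finType) (n : nat) (f : transformation A n) :
  2 <= #|A| -> 2 <= n -> bijective f ->
  (forall m : nat, n = 2 * m -> computed_in_at_most f (3 * m) m) /\
  (forall m : nat, n = 2 * m + 1 -> computed_in_at_most f (3 * m + 3) (m + 2)).
Proof.
move=> A2 n2 /bij_inj injf; have A0 := ltnW A2; split=> m nE.
  exists (3 * m) => //; apply: computed_in_blocks => //; first by rewrite nE.
  by rewrite nE !mulSn addn0 addnA.
exists (3 * m + 3) => //.
(* Blocks of size [m + 1]: the [2m + 1] inputs leave one spare cell in the first two blocks, and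
   [m + 1] cells form the third. *)
rewrite -mulnSr; apply: computed_in_blocks => //; first by rewrite nE mulnSr leq_add2l.
by rewrite nE addnACA -mulSnr mulnSr.
Qed.
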